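(* Let $\mathcal{H}$ be a real Hilbert space, $A:\mathcal{H}\rightrightarrows\mathcal{H}$ a maximally monotone operator, and $B:\mathcal{H}\to\mathcal{H}$ a monotone and $\frac1\beta$-Lipschitz continuous operator with $\beta>0$. Let $A+B$ be $\rho$-strongly monotone for some $\rho>0$, and let $\bar x\in\mathrm{Zer}(A+B)$. Let $\gamma:[0,+\infty)\to(0,\beta)$ be Lebesgue measurable, let $x_0\in\mathcal{H}$, and let $x,z:[0,+\infty)\to\mathcal{H}$ be the trajectories generated by $$z(t)=J_{\gamma(t)A}\big(x(t)-\gamma(t)Bx(t)\big),\qquad 0=\dot x(t)+x(t)-z(t)-\gamma(t)Bx(t)+\gamma(t)Bz(t),\qquad x(0)=x_0.$$ Then for every $t\in[0,+\infty)$ $$\|x(t)-\bar x\|^2\le \frac{\|x(0)-\bar x\|^2}{\exp\left(\int_0^t\frac{2\rho\gamma(s)(\beta-\gamma(s))}{\beta\rho\gamma(s)+\beta-\gamma(s)}\,ds\right)}.$$ In particular, if $$\int_0^{+\infty}\frac{2\rho\gamma(s)(\beta-\gamma(s))}{\beta\rho\gamma(s)+\beta-\gamma(s)}\,ds=+\infty,$$ then $x(t)$ converges in norm to the unique element of $\mathrm{Zer}(A+B)$ as $t\to+\infty$.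
   Context: $J_{\gamma A}=(\mathrm{Id}+\gamma A)^{-1}$ is the resolvent of $\gamma A$ (single-valued and everywhere defined for $\gamma>0$). $\mathrm{Zer}(M)=\{x\in\mathcal{H}: 0\in Mx\}$. A set-valued operator $M:\mathcal{H}\rightrightarrows\mathcal{H}$ is $\rho$-strongly monotone if $\langle x-y,x^*-y^*\rangle\ge\rho\|x-y\|^2$ for all $x,y\in\mathcal{H}$, $x^*\in Mx$, $y^*\in My$. The differential system is understood in the strong global sense: $x$ is locally absolutely continuous on $[0,+\infty)$ (i.e. on each $[0,b]$, $0<b<+\infty$, it is the integral of an integrable function $\dot x$ plus the constant $x(0)$), $z(t)$ is defined by the first equation for all $t$, the second equation holds for almost every $t\in[0,+\infty)$, and $x(0)=x_0$. Such a solution exists and is unique. *)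

(* Defs.v *)
From HB Require Import structures.
From mathcomp Require Import all_boot all_order all_algebra.
From mathcomp Require Import sesquilinear.
From mathcomp Require Import all_classical all_reals all_analysis.

Set Implicit Arguments.
Unset Strict Implicit.
Unset Printing Implicit Defensive.

Import Order.TTheory GRing.Theory Num.Theory.
Import numFieldNormedType.Exports.

Local Open Scope classical_set_scope.
Local Open Scope ring_scope.

HB.mixin Record isHilbert (R : realType) H & CompleteNormedModule R H := {
  inner : {dot H for (@idfun R)} ;
  inner_norm : forall u : H, inner u u = `|u| ^+ 2
}.

#[short(type="hilbertType")]
HB.structure Definition Hilbert (R : realType) :=
  {H of CompleteNormedModule R H & isHilbert R H}.

(* A set-valued operator maps each point to the set of its images, [M x u]
   meaning that [(x, u)] is in its graph. *)
Notation operator H := (H -> set H).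

Section Operators.
Context {R : realType} {H : hilbertType R}.
Implicit Types (M N : operator H) (f : H -> H).

Definition op_fun f : operator H := fun x => [set f x].

Definition op_add M N : operator H :=
  fun x => [set u + v | u in M x & v in N x].

Definition op_scale (c : R) M : operator H := fun x => [set c *: u | u in M x].

Definition op_inv M : operator H := fun u => [set x | M x u].

Definition Zer M : set H := [set x | M x 0].

Definition monotone_op M :=
  forall x y u v : H, M x u -> M y v -> 0 <= inner (x - y) (u - v).

Definition strongly_monotone (rho : R) M :=
  forall x y u v : H, M x u -> M y v ->
    rho * `|x - y| ^+ 2 <= inner (x - y) (u - v).

Definition maximally_monotone M :=
  monotone_op M /\
  forall N, monotone_op N -> (forall x, M x `<=` N x) -> N = M.

(* [resolvent c A] is [J_{cA}], kept set-valued: [J_{cA} u = p] is written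
   [resolvent c A u = [set p]]. *)
Definition resolvent (c : R) M : operator H :=
  op_inv (op_add (op_fun id) (op_scale c M)).

End Operators.

Section Bochner.
Context d (T : measurableType d) (R : realType) (V : normedModType R).
Variable mu : {measure set T -> \bar R}.
Implicit Types (D : set T) (s f : T -> V).

Definition simple_on D s :=
  [/\ finite_set (range s),
      forall v, measurable (D `&` s @^-1` [set v]) &
      forall v, v != 0 -> (mu (D `&` s @^-1` [set v]) < +oo)%E].

Definition simple_integral D s : V :=
  \sum_(v \in range s) fine (mu (D `&` s @^-1` [set v])) *: v.

(* [f] is Bochner integrable on [D] with integral [I]. The norms
   [`|f t - s n t|] are measurable on [D] when [mu] is complete, the only case
   used below. *)
Definition is_bochner_integral D f (I : V) :=
  exists s : nat -> T -> V,
    [/\ forall n, simple_on D (s n),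
        {ae mu, forall t, D t -> s n t @[n --> \oo] --> f t},
        (\int[mu]_(t in D) (`|f t - s n t|)%:E)%E @[n --> \oo] --> 0%E &
        simple_integral D (s n) @[n --> \oo] --> I].

End Bochner.

(* The real line with the sigma-algebra of Lebesgue measurable sets
   (measurable in the sense of Caratheodory), on which
   [completed_lebesgue_measure] lives; [R] itself carries the Borel sets. *)
Notation lebesgueTypeR R :=
  (caratheodory_type (mu_ext (wlength (@idfun (Real.sort R))))).

Notation leb := completed_lebesgue_measure.

Section Trajectory.
Context {R : realType} {H : hilbertType R}.

Definition is_derivative_ac (x dx : R -> H) :=
  forall t : R, 0 <= t ->
    is_bochner_integral (@leb R) `[0, t] dx (x t - x 0).

(* Strong global solutions; [x] and [z] matter only on [[0, +oo[]. *)
Definition is_trajectory (A : operator H) (B : H -> H) (gamma : R -> R)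
    (x0 : H) (x z : R -> H) :=
  exists dx : R -> H,
    [/\ is_derivative_ac x dx,
        forall t : R, 0 <= t ->
          resolvent (gamma t) A (x t - gamma t *: B (x t)) = [set z t],
        {ae @leb R, forall t : R, 0 <= t ->
          0 = dx t + x t - z t - gamma t *: B (x t) + gamma t *: B (z t)} &
        x 0 = x0].

End Trajectory.

(* Main.v *)
Require Import Defs.
From HB Require Import structures.
From mathcomp Require Import all_boot all_order all_algebra finmap.
From mathcomp Require Import all_classical all_reals all_analysis.
From mathcomp Require Import measurable_realfun ring lra.

(** With w = x - z - gamma B x + gamma B z one has w in gamma (A + B) z, so
    strong monotonicity gives <w, z - xbar> >= gamma rho |z - xbar|^2, while the
    Lipschitz bound on B gives <w, x - z> >= (1 - gamma / beta) |x - z|^2.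
    Adding these, and using a m^2 + b n^2 >= ab / (a + b) (m + n)^2, bounds
    2 <w, x - xbar> below by g |x - xbar|^2, where g is the integrand of the
    theorem; that is, phi = |x - xbar|^2 formally satisfies phi' <= - g phi.

    No differentiation of phi is needed: testing the Bochner integral of x'
    over ]s, t] against the fixed vector x s - xbar, and using that x is
    Lipschitz on [0, T], yields
      phi t <= phi s (1 - int_s^t g) + O((t - s)^2),
    hence psi t <= psi s + O((t - s)^2) for psi t = phi t exp (int_0^t g).
    Summing over ever finer subdivisions of [0, T] gives psi T <= psi 0. *)

Set Implicit Arguments.
Unset Strict Implicit.
Unset Printing Implicit Defensive.

Import Order.TTheory GRing.Theory Num.Theory.
Import numFieldNormedType.Exports.

Local Open Scope classical_set_scope.
Local Open Scope ring_scope.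

(** * Inner product calculus and the Cauchy-Schwarz inequality *)

Section InnerProduct.
Context {R : realType} {H : hilbertType R}.
Implicit Types u v w : H.

Lemma innerC u v : inner u v = inner v u.
Proof. by rewrite hermC /= expr0 mul1r. Qed.

Lemma innerDl u v w : inner (u + v) w = inner u w + inner v w.
Proof. exact: linearDl. Qed.

Lemma innerDr u v w : inner w (u + v) = inner w u + inner w v.
Proof. exact: linearDr. Qed.

Lemma innerZl a u v : inner (a *: u) v = a * inner u v.
Proof. exact: linearZl_LR. Qed.

Lemma innerZr a u v : inner u (a *: v) = a * inner u v.
Proof. exact: linearZr. Qed.

Lemma innerNl u v : inner (- u) v = - inner u v.
Proof. by rewrite -scaleN1r innerZl mulN1r. Qed.

Lemma innerNr u v : inner u (- v) = - inner u v.
Proof. by rewrite -scaleN1r innerZr mulN1r. Qed.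

Lemma inner0l v : inner 0 v = 0.
Proof. by rewrite -(scale0r 0) innerZl mul0r. Qed.

Lemma sqr_normB u v : `|u - v| ^+ 2 = `|u| ^+ 2 - 2 * inner u v + `|v| ^+ 2.
Proof.
rewrite -!inner_norm innerDl !innerDr !innerNl !innerNr (innerC v u).
by ring.
Qed.

(** Expanding the nonnegative square of | |v| u - |u| v | gives the bound multiplied by 2 |u| |v|,
    which is positive once the zero vectors are set aside. *)
Lemma inner_le_norm u v : inner u v <= `|u| * `|v|.
Proof.
have [->|u0] := eqVneq u 0; first by rewrite inner0l normr0 mul0r.
have [->|v0] := eqVneq v 0; first by rewrite innerC inner0l normr0 mulr0.
have uv_gt0 : 0 < `|u| * `|v| by rewrite mulr_gt0 ?normr_gt0.
have := sqr_ge0 `| `|v| *: u - `|u| *: v|.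
rewrite sqr_normB innerZl innerZr !normrZ !normr_id => h.
rewrite -(ler_pM2l uv_gt0); move: h; set a := `|u|; set b := `|v|; nra.
Qed.

Lemma Cauchy_Schwarz u v : `|inner u v| <= `|u| * `|v|.
Proof.
rewrite ler_norml inner_le_norm andbT lerNl -innerNl.
by rewrite (le_trans (inner_le_norm _ _))// normrN.
Qed.

Lemma continuous_innerl v : continuous (fun u => inner u v).
Proof.
move=> u; apply/cvgrPdist_lt => e e0.
near=> w; rewrite -innerNl -innerDl.
apply: le_lt_trans (Cauchy_Schwarz _ _) _.
(* The extra 1 keeps the divisor positive when v = 0. *)
apply: (@le_lt_trans _ _ (`|u - w| * (`|v| + 1))).
  by rewrite ler_wpM2l// lerDl.
rewrite -ltr_pdivlMr ?ltr_wpDl//.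
near: w; apply: cvgr_dist_lt; first exact: cvg_id.
by rewrite divr_gt0// ltr_wpDl.
Unshelve. all: by end_near. Qed.

End InnerProduct.

(** * Pointwise estimates for one forward-backward-forward step *)

Section Tseng.
Context {R : realType} {H : hilbertType R}.

(** After multiplication by a + b, the two sides differ by exactly (a m - b n)^2. *)
Lemma parallel_sum_le (a b m n : R) : 0 < a -> 0 < b ->
  a * b / (a + b) * (m + n) ^+ 2 <= a * m ^+ 2 + b * n ^+ 2.
Proof.
move=> a0 b0; rewrite mulrAC ler_pdivrMr ?addr_gt0//.
by have := sqr_ge0 (a * m - b * n); nra.
Qed.

Variables (A : operator H) (B : H -> H) (beta rho c : R) (xbar x z : H).
Hypotheses (beta_gt0 : 0 < beta) (rho_gt0 : 0 < rho) (c_range : 0 < c < beta).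
Hypotheses (B_lip : (beta^-1).-lipschitz B).
Hypothesis xbar_zer : Zer (op_add A (op_fun B)) xbar.
Hypothesis xz : resolvent c A (x - c *: B x) z.

Let lipB u v : c * `|B u - B v| <= c / beta * `|u - v|.
Proof.
have /andP[c0 _] := c_range.
by rewrite -mulrA ler_pM2l//; have := B_lip (x := (u, v)); apply.
Qed.

Let c_div_lt1 : c / beta < 1.
Proof. by have /andP[_ ?] := c_range; rewrite ltr_pdivrMr// mul1r. Qed.

Let stepE : x - z - c *: B x + c *: B z = (x - z) - c *: (B x - B z).
Proof. by rewrite scalerBr opprB addrA addrAC. Qed.

Let innerE := (@innerDl, @innerDr, @innerNl, @innerNr, @innerZl, @innerZr).

(** This makes the velocity at most linear in the distance to the zero, hence the trajectory
    Lipschitz on bounded intervals. The constant is 6 = 2 * 3: |z - xbar| <= 2 |x - xbar| gives |x -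
    z| <= 3 |x - xbar|, and the term in B adds at most another |x - z| because c / beta < 1. *)
Lemma Tseng_step_le : monotone_op A ->
  `|x - z - c *: B x + c *: B z| <= 6 * `|x - xbar|.
Proof.
move=> A_mono; have /andP[c0 _] := c_range.
have [_ -> [_ [p Azp <-] zp]] := xz.
have [a Aa [_ -> aB]] := xbar_zer.
have cp : c *: p = x - c *: B x - z by rewrite -zp addrC addKr.
have zx : `|z - xbar| <= 2 * `|x - xbar|.
  have aE : a = - B xbar by apply/eqP; rewrite -addr_eq0 aB.
  (* Monotonicity between (z, p) and (xbar, - B xbar), scaled by c so that the resolvent equation
     eliminates p. *)
  have := A_mono _ _ _ _ Azp Aa; rewrite -(pmulr_rge0 _ c0) -innerZr.
  rewrite scalerBr cp aE.
  have -> : inner (z - xbar) (x - c *: B x - z - c *: - B xbar) =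
      inner (z - xbar) ((x - xbar) - c *: (B x - B xbar)) - `|z - xbar| ^+ 2.
    by rewrite -inner_norm !innerE; ring.
  rewrite subr_ge0 => h.
  have {}h := le_trans h (inner_le_norm _ _).
  have [->|/eqP zx0] := eqVneq z xbar; first by rewrite subrr normr0 mulr_ge0.
  have zx0' : 0 < `|z - xbar| by rewrite normr_gt0 subr_eq0; apply/eqP.
  move: h; rewrite expr2 ler_pM2l// => /le_trans; apply.
  rewrite (le_trans (ler_normB _ _))// normrZ gtr0_norm//.
  rewrite mulr_natl mulr2n lerD2l.
  by rewrite (le_trans (lipB _ _))// ler_piMl// ltW.
have xz_le : `|x - z| <= 3 * `|x - xbar|.
  by have := ler_distD xbar x z; rewrite (distrC xbar); lra.
rewrite stepE (le_trans (ler_normB _ _))// normrZ gtr0_norm//.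
suff : c * `|B x - B z| <= `|x - z| by lra.
by rewrite (le_trans (lipB _ _))// ler_piMl// ltW.
Qed.

Lemma Tseng_step_dissipation : strongly_monotone rho (op_add A (op_fun B)) ->
  2 * rho * c * (beta - c) / (beta * rho * c + beta - c) * `|x - xbar| ^+ 2 <=
  2 * inner (x - z - c *: B x + c *: B z) (x - xbar).
Proof.
move=> AB_strong; have /andP[c0 cb] := c_range.
have [_ -> [_ [p Azp <-] zp]] := xz.
have cp : c *: p = x - c *: B x - z by rewrite -zp addrC addKr.
have strong : c * rho * `|z - xbar| ^+ 2 <=
    inner (x - z - c *: B x + c *: B z) (z - xbar).
  have -> : x - z - c *: B x + c *: B z = c *: (p + B z).
    by rewrite scalerDr cp -[in RHS](addrAC x).
  rewrite innerZl -mulrA ler_pM2l// innerC -[X in inner _ X]subr0.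
  by apply: AB_strong => //; exists p => //; exists (B z).
have lip : (1 - c / beta) * `|x - z| ^+ 2 <=
    inner (x - z - c *: B x + c *: B z) (x - z).
  rewrite stepE innerDl innerNl inner_norm innerZl mulrBl mul1r lerD2l lerN2.
  rewrite expr2 mulrA.
  apply: (@le_trans _ _ (c * (`|B x - B z| * `|x - z|))).
    by rewrite ler_pM2l// inner_le_norm.
  by rewrite mulrA ler_wpM2r.
have -> : x - xbar = (x - z) + (z - xbar) by rewrite addrA subrK.
rewrite [in leRHS]innerDr.
have a0 : 0 < 1 - c / beta by rewrite subr_gt0.
have cr0 : 0 < c * rho by rewrite mulr_gt0.
have := parallel_sum_le `|x - z| `|z - xbar| a0 cr0.
(* Cancelling beta exhibits the rate as 2 a b / (a + b) with a = 1 - c / beta and b = c rho, the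
   weights of the two lower bounds. *)
have -> : 2 * rho * c * (beta - c) / (beta * rho * c + beta - c) =
    2 * ((1 - c / beta) * (c * rho) / (1 - c / beta + c * rho)).
  have d0 : beta * rho * c + beta - c != 0.
    by rewrite -addrA gt_eqF// addr_gt0 ?mulr_gt0// subr_gt0.
  have e0 : beta - c + c * rho * beta != 0 by move: d0; congr (_ != 0); ring.
  by field; rewrite e0 gt_eqF.
set k := (1 - c / beta) * (c * rho) / (1 - c / beta + c * rho) => par.
have k0 : 0 <= k.
  by apply: ltW; apply: divr_gt0; [exact: mulr_gt0|exact: addr_gt0].
have : k * `|x - z + (z - xbar)| ^+ 2 <= k * (`|x - z| + `|z - xbar|) ^+ 2.
  by rewrite ler_wpM2l// lerXn2r ?nnegrE ?addr_ge0// ler_normD.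
lra.
Qed.

End Tseng.

(** * Bochner integrals: measurability, integrability of the norm, and scalar testing *)

Section BochnerTheory.
Context d (T : measurableType d) (R : realType).
Variables (mu : {measure set T -> \bar R}) (D : set T).
Hypotheses (mu_complete : measure_is_complete mu) (mD : measurable D).

Section NormedTarget.
Context {V : normedModType R}.
Implicit Types (s f : T -> V).

(** The finitely many level sets of s cut D into measurable pieces, and on each of them the function
    is some [F v] with v fixed. *)
Lemma simple_on_measurable_comp s (F : V -> T -> R) : simple_on mu D s ->
  (forall v, measurable_fun D (F v)) -> measurable_fun D (fun t => F (s t) t).
Proof.
move=> [fin_s ms _] mF _ Y mY.
rewrite (_ : _ `&` _ = \bigcup_(v in range s)
    ((D `&` s @^-1` [set v]) `&` (D `&` F v @^-1` Y))).
  apply: fin_bigcup_measurable => // v _.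
  by apply: measurableI => //; exact: mF.
apply/seteqP; split=> [t [Dt Yt]|t [v _ [[Dt /= <-] [_ Yt]]]//].
by exists (s t).
Qed.

(** On D, h o s is the finite sum of h v times the indicator of the level set of v. The level set of
    0 may have infinite measure; h 0 = 0 removes its contribution. *)
Lemma simple_on_integral s (h : V -> R) : h 0 = 0 -> simple_on mu D s ->
  mu.-integrable D (fun t => (h (s t))%:E) /\
  \int[mu]_(t in D) h (s t) =
    \sum_(v \in range s) fine (mu (D `&` s @^-1` [set v])) * h v.
Proof.
move=> h0 [fin_s ms s_fin].
pose E v := D `&` s @^-1` [set v].
pose g v t := ((h v)%:E * (\1_(E v) t)%:E)%E.
have hE v : h v != 0 -> (mu (E v) < +oo)%E.
  by move=> hv0; apply: s_fin; apply/eqP => v0; move: hv0; rewrite v0 h0 eqxx.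
have int1 v : (\int[mu]_(t in D) (\1_(E v) t)%:E = mu (E v))%E.
  by rewrite integral_indic//; [rewrite setIC setIA setIid|exact: ms].
have i1 v : h v != 0 -> mu.-integrable D (fun t => (\1_(E v) t)%:E).
  move=> hv0; apply/integrableP; split.
    exact/measurable_EFinP/measurable_indic/ms.
  under eq_integral do rewrite gee0_abs ?lee_fin//.
  by rewrite int1 hE.
have ig v : mu.-integrable D (g v).
  have [hv0|hv0] := eqVneq (h v) 0.
    rewrite /g hv0 (_ : (fun _ => _) = cst 0%E); first exact: integrable0.
    by apply/funext => t; rewrite mul0e.
  by apply: integrableZl => //; exact: i1.
have sum_g t : D t -> (h (s t))%:E = (\sum_(v \in range s) g v t)%E.
  move=> Dt; rewrite (fsbigD1 (s t))//=; last by exists t.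
  rewrite [X in (_ + X)%E]fsbig1 ?adde0/g ?indicE ?mem_set ?mule1//= => v.
  move=> [_ /= /eqP vs]; rewrite indicE memNset ?mule0//= => -[_ /= sv].
  by rewrite sv eqxx in vs.
have hsE : {in D, (fun t => \sum_(v <- fset_set (range s)) g v t)%E =1
    (fun t => (h (s t))%:E)}.
  by move=> t; rewrite inE => Dt; rewrite sum_g// fsbig_finite.
split; first by apply: (eq_integrable mD _ _ hsE); exact: integrable_sum.
rewrite /Rintegral -(eq_integral _ _ hsE) integral_sum//.
have gE v : (\int[mu]_(t in D) g v t = (fine (mu (E v)) * h v)%:E)%E.
  have [hv0|hv0] := eqVneq (h v) 0.
    by rewrite /g hv0 mulr0 integral0_eq// => t _; rewrite mul0e.
  by rewrite integralZl ?i1// int1 mulrC EFinM fineK// ge0_fin_numE// hE.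
under eq_bigr do rewrite gE.
by rewrite sumEFin/= fsbig_finite.
Qed.

(** Off a null set, h o f is a pointwise limit of measurable functions; inside the null set,
    completeness of [mu] makes every subset measurable. *)
Lemma ae_limit_measurable_comp (s_ : nat -> T -> V) f (h : V -> R) :
  continuous h -> (forall n, simple_on mu D (s_ n)) ->
  {ae mu, forall t, D t -> s_ n t @[n --> \oo] --> f t} ->
  measurable_fun D (h \o f).
Proof.
move=> h_cont ss [N [mN N0 subN]] _ Y mY.
have mDN : measurable (D `\` N) by exact: measurableD.
have mf : measurable_fun (D `\` N) (h \o f).
  apply: (@measurable_fun_cvg _ _ _ _ (fun n => h \o s_ n)) => [n|t [Dt Nt]].
    apply: (measurable_funS mD) => //.
    by apply: (simple_on_measurable_comp (F := fun v _ => h v)).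
  apply: continuous_cvg; first exact: h_cont.
  by move: Dt; apply: contrapT => ?; apply/Nt/subN.
rewrite (_ : _ `&` _ = ((D `\` N) `&` (h \o f) @^-1` Y) `|`
    (D `&` N `&` (h \o f) @^-1` Y)).
  apply: measurableU; first exact: mf.
  by apply: mu_complete; exists N; split=> // t [[]].
rewrite -setIUl; congr (_ `&` _); rewrite setDE -setIUr.
by rewrite [_ `|` N]setUC setUCr setIT.
Qed.

Lemma bochner_measurable_dist f I s : is_bochner_integral mu D f I ->
  simple_on mu D s -> measurable_fun D (fun t => `|f t - s t|).
Proof.
move=> [s_ [ss sf _ _]] hs.
apply: (simple_on_measurable_comp (F := fun v t => `|f t - v|)) => // v.
apply: (ae_limit_measurable_comp (h := fun u => `|u - v|) _ ss sf) => u.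
by apply: cvg_norm; apply: cvgB; [exact: cvg_id|exact: cvg_cst].
Qed.

(** The triangle inequality dominates |f| by |f - s| + |s|, where s is a simple approximant at
    finite L1 distance from f. *)
Lemma bochner_norm_integrable f I : is_bochner_integral mu D f I ->
  mu.-integrable D (fun t => `|f t|%:E).
Proof.
move=> bf; have [s_ [ss sf sf0 _]] := bf.
have mf : measurable_fun D (fun t => `|f t|).
  apply: (ae_limit_measurable_comp (h := fun u => `|u|) _ ss sf).
  exact: norm_continuous.
(* Convergence of the extended real integrals to 0 forces them to be finite from some index on. *)
have [n sn1] : exists n, (\int[mu]_(t in D) `|f t - s_ n t|%:E < +oo)%E.
  have /fine_cvgP[[n _ /(_ n (leqnn n)) fin_n] _] := sf0.
  by exists n; move: fin_n; rewrite fin_numElt => /andP[].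
have [is_ _] := simple_on_integral (normr0 V) (ss n).
have md : measurable_fun D (fun t => `|f t - s_ n t|).
  exact: bochner_measurable_dist bf (ss n).
have id_ : mu.-integrable D (fun t => `|f t - s_ n t|%:E).
  apply/integrableP; split; first exact/measurable_EFinP.
  by under eq_integral do rewrite gee0_abs ?lee_fin//.
apply: (le_integrable mD _ _ (integrableD mD id_ is_)) => //.
  exact/measurable_EFinP.
move=> t Dt; rewrite -EFinD !gee0_abs ?lee_fin ?addr_ge0//.
by rewrite -[in leLHS](subrK (s_ n t) (f t)) ler_normD.
Qed.

Lemma bochner_dist_integrable f I s : is_bochner_integral mu D f I ->
  simple_on mu D s -> mu.-integrable D (fun t => `|f t - s t|%:E).
Proof.
move=> bf hs; have [is_ _] := simple_on_integral (normr0 V) hs.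
apply: (le_integrable mD _ _
  (integrableD mD (bochner_norm_integrable bf) is_)) => //.
  exact/measurable_EFinP/(bochner_measurable_dist bf).
move=> t Dt; rewrite -EFinD !gee0_abs ?lee_fin ?addr_ge0//.
exact: ler_normB.
Qed.

End NormedTarget.

Context {H : hilbertType R}.

(** The numbers <simple integral of s_n, v> have two limits, which must agree: <I, v> by continuity
    of the inner product, and the integral of <f, v> by Cauchy-Schwarz and L1 convergence. Vector
    integrals are thereby handled through real ones. *)
Lemma bochner_integral_inner (f : T -> H) I v : is_bochner_integral mu D f I ->
  mu.-integrable D (fun t => (inner (f t) v)%:E) /\
  \int[mu]_(t in D) inner (f t) v = inner I v.
Proof.
move=> bf; have [s_ [ss sf sf0 sI]] := bf.
have ifv : mu.-integrable D (fun t => (inner (f t) v)%:E).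
  apply: (le_integrable mD _ _
    (integrableZl mD `|v| (bochner_norm_integrable bf))) => //.
    apply/measurable_EFinP.
    apply: (ae_limit_measurable_comp (h := fun u => inner u v) _ ss sf).
    exact: continuous_innerl.
  move=> t Dt; rewrite -EFinM [leRHS]gee0_abs ?lee_fin ?mulr_ge0// mulrC.
  exact: Cauchy_Schwarz.
split=> //.
have isv n := simple_on_integral (h := fun u => inner u v) (inner0l v) (ss n).
have simple_inner n : inner (simple_integral mu D (s_ n)) v =
    \int[mu]_(t in D) inner (s_ n t) v.
  rewrite (isv n).2 /simple_integral; have [fin_s _ _] := ss n.
  rewrite !fsbig_finite//=.
  elim/big_ind2 : _ => [|a b a' b' <- <-|u _]; first exact: inner0l.
    by rewrite innerDl.
  by rewrite innerZl.
have inner_cvg :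
    inner (simple_integral mu D (s_ n)) v @[n --> \oo] --> inner I v.
  exact: (cvg_comp _ _ sI (@continuous_innerl _ _ v I)).
have int_cvg : inner (simple_integral mu D (s_ n)) v @[n --> \oo] -->
    \int[mu]_(t in D) inner (f t) v.
  apply/subr_cvg0; apply: norm_cvg0.
  pose e n := `|v| * \int[mu]_(t in D) `|f t - s_ n t|.
  have e0 : e n @[n --> \oo] --> 0.
    rewrite -[X in _ --> X](mulr0 `|v|); apply: cvgM; first exact: cvg_cst.
    exact: (fine_cvg sf0).
  apply: (squeeze_cvgr _ (cvg_cst 0) e0); near=> n.
  have id_ := bochner_dist_integrable bf (ss n).
  rewrite normr_ge0 simple_inner -RintegralB//; last by case: (isv n).
  apply: le_trans (le_normr_Rintegral _ _) _ => //.
    exact: (integrableB mD (isv n).1 ifv).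
  rewrite /e -RintegralZl//; apply: le_Rintegral => //.
  - exact/integrable_norm/(integrableB mD (isv n).1 ifv).
  - exact: (integrableZl mD `|v| id_).
  move=> t Dt; rewrite -innerNl -innerDl (distrC (f t)) mulrC.
  exact: Cauchy_Schwarz.
exact: cvg_unique int_cvg inner_cvg.
Unshelve. all: by end_near. Qed.

End BochnerTheory.

(** * Intervals under the completed Lebesgue measure *)

Section CompletedLebesgue.
Context {R : realType}.
Local Notation LT := (lebesgueTypeR R).

Lemma lebesgue_measurable_itv (i : interval R) : measurable ([set` i] : set LT).
Proof. by apply: sub_caratheodory; exact: measurable_itv. Qed.

Lemma leb_itv (a b : R) (b0 b1 : bool) : a <= b ->
  leb ([set` Interval (BSide b0 a) (BSide b1 b)] : set LT) = (b - a)%:E.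
Proof.
move=> ab; rewrite EFinB.
(* The Borel formula carries over because both measures unfold to the same set function. *)
have := @lebesgue_measure_itv R (Interval (BSide b0 a) (BSide b1 b)).
rewrite /lebesgue_measure /lebesgue_stieltjes_measure /= lte_fin.
move: ab; rewrite le_eqVlt => /predU1P[->|->]//.
by rewrite ltxx -EFinB subrr => h; exact: h.
Qed.

End CompletedLebesgue.

(** * Comparison of integrals almost everywhere, and of values by subdivision *)

Lemma ae_le_Rintegral d (T : measurableType d) (R : realType)
    (mu : {measure set T -> \bar R}) (D : set T) (f g : T -> R) :
  measurable D ->
  mu.-integrable D (EFin \o f) -> mu.-integrable D (EFin \o g) ->
  {ae mu, forall t, D t -> f t <= g t} ->
  \int[mu]_(t in D) f t <= \int[mu]_(t in D) g t.
Proof.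
move=> mD intf intg [N [mN N0 subN]].
rewrite /Rintegral (negligible_integral mN mD intf N0).
rewrite (negligible_integral mN mD intg N0).
have mDN : measurable (D `\` N) by exact: measurableD.
have subD : D `\` N `<=` D by move=> t [].
apply: (le_Rintegral mDN); [exact: integrableS intf|exact: integrableS intg|].
by move=> t [Dt Nt]; move: Dt; apply: contrapT => ?; exact/Nt/subN.
Qed.

(** Over n equal steps the errors add up to n C (T / n)^2 = C T^2 / n, which vanishes as n grows. *)
Lemma le_of_quadratic_increments (R : realType) (psi : R -> R) (T C : R) :
  0 <= T ->
  (forall s t, 0 <= s -> s <= t -> t <= T ->
    psi t <= psi s + C * (t - s) ^+ 2) ->
  psi T <= psi 0.
Proof.
move=> T0 psi_incr; apply/ler_addgt0Pr => e e0.
(* Large enough for C T^2 / n <= e; the successor keeps n positive. *)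
pose n := (Num.bound (`|C * T ^+ 2| / e)).+1.
have n0 : 0 < n%:R :> R by rewrite ltr0n.
have step k : (k <= n)%N ->
    psi (T * k%:R / n%:R) <= psi 0 + k%:R * (C * (T / n%:R) ^+ 2).
  elim: k => [_|k IHk kn]; first by rewrite mulr0 !mul0r addr0.
  have := psi_incr (T * k%:R / n%:R) (T * k.+1%:R / n%:R).
  rewrite divr_ge0 ?mulr_ge0// ler_pM2r ?invr_gt0// ler_wpM2l ?ler_nat//.
  rewrite ler_pdivrMr// ler_wpM2l ?ler_nat// => /(_ isT isT isT).
  rewrite -mulrBl -mulrBr -natrB// subSnn mulr1 => h.
  have kS : k.+1%:R * (C * (T / n%:R) ^+ 2) =
      k%:R * (C * (T / n%:R) ^+ 2) + C * (T / n%:R) ^+ 2.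
    by rewrite -natr1 mulrDl mul1r.
  by have := IHk (ltnW kn); rewrite kS; lra.
have := step n (leqnn n); rewrite mulfK ?gt_eqF// => /le_trans; apply.
have -> : n%:R * (C * (T / n%:R) ^+ 2) = C * T ^+ 2 / n%:R.
  by field; rewrite gt_eqF.
rewrite lerD2l ler_pdivrMr//.
apply: le_trans (ler_norm _) _; rewrite -ler_pdivrMl// mulrC.
have := archi_boundP (divr_ge0 (normr_ge0 (C * T ^+ 2)) (ltW e0)).
by move=> /ltW/le_trans; apply; rewrite ler_nat.
Qed.

(** * Increments of absolutely continuous curves and a Gronwall inequality *)

Section Gronwall.
Context {R : realType} {H : hilbertType R}.
Local Notation LT := (lebesgueTypeR R).
Variables (x dx : R -> H).
Hypothesis x_ac : is_derivative_ac x dx.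

Let ae_leb_filter : Filter (almost_everywhere (@leb R)).
Proof. exact: (ae_filter_ringOfSetsType (@leb R)). Qed.

Let mitv (i : interval R) := @lebesgue_measurable_itv R i.

Let itv0t_setU (s t : R) : 0 <= s -> s <= t ->
  `[0, t]%classic = `[0, s]%classic `|` `]s, t]%classic.
Proof. by move=> s0 st; apply: itv_bndbnd_setU; rewrite bnd_simp. Qed.

Let disj0s (s t : R) : [disjoint `[0%R, s]%classic & `]s, t]%classic].
Proof.
apply/disj_setPS => r [/=]; rewrite !in_itv/= => /andP[_ rs] /andP[sr _].
by move: rs; rewrite leNgt sr.
Qed.

Let sub_itv0 (s t : R) : 0 <= s -> `]s, t] `<=` `[0, t]%classic.
Proof.
move=> s0 r /=; rewrite !in_itv/= => /andP[sr ->].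
by rewrite (le_trans s0 (ltW sr)).
Qed.

(** The tested integrals over [0, t] and [0, s] are subtracted; the left-open interval makes the
    decomposition of [0, t] disjoint. *)
Lemma ac_increment_inner (s t : R) (v : H) : 0 <= s -> s <= t ->
  (@leb R).-integrable (`]s, t]%classic : set LT)
    (fun r => (inner (dx r) v)%:E) /\
  \int[leb]_(r in (`]s, t]%classic : set LT)) inner (dx r) v =
    inner (x t - x s) v.
Proof.
move=> s0 st; have t0 := le_trans s0 st.
have cplt := @completed_lebesgue_measure_is_complete R.
have [it It] := bochner_integral_inner cplt (mitv _) v (x_ac t0).
have [_ Is] := bochner_integral_inner cplt (mitv _) v (x_ac s0).
split.
  exact: (integrableS (mitv _) (mitv _) (@sub_itv0 s t s0) it).
move: It; rewrite (itv0t_setU s0 st).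
rewrite Rintegral_setU//; last by rewrite -itv0t_setU.
rewrite Is => h; apply: (addrI (inner (x s - x 0) v)).
by rewrite h -innerDl [in RHS]addrC subrKA.
Qed.

Lemma ac_derivative_norm_integrable (s t : R) : 0 <= s -> s <= t ->
  (@leb R).-integrable (`]s, t]%classic : set LT) (fun r => `|dx r|%:E).
Proof.
move=> s0 st; have t0 := le_trans s0 st.
have cplt := @completed_lebesgue_measure_is_complete R.
apply: (integrableS (mitv _) (mitv _) (@sub_itv0 s t s0)).
exact: (bochner_norm_integrable cplt (mitv _) (x_ac t0)).
Qed.

(** Testing against the increment x t - x s itself yields its squared norm, and one factor is then
    cancelled. *)
Lemma ac_increment_norm (s t : R) : 0 <= s -> s <= t ->
  `|x t - x s| <= \int[leb]_(r in (`]s, t]%classic : set LT)) `|dx r|.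
Proof.
move=> s0 st; have idx := ac_derivative_norm_integrable s0 st.
have [iv Iv] := ac_increment_inner (x t - x s) s0 st.
have [->|xts] := eqVneq (x t - x s) 0; first by rewrite normr0 Rintegral_ge0.
rewrite -(@ler_pM2l _ `|x t - x s|) ?normr_gt0// -expr2 -inner_norm -Iv.
rewrite -RintegralZl//.
apply: le_Rintegral => //.
  exact: (integrableZl (mitv _) `|x t - x s| idx).
by move=> r _; rewrite mulrC inner_le_norm.
Qed.

(** * Exponential decay from a velocity bound and a dissipation inequality *)

Section Estimates.
Variables (c : H) (g : R -> R) (L M : R).
Hypotheses (L0 : 0 <= L) (M0 : 0 <= M).
Hypothesis dx_le : {ae @leb R, forall t : R, 0 <= t ->
  `|dx t| <= L * `|x t - c|}.
Hypothesis dissipation : {ae @leb R, forall t : R, 0 <= t ->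
  2 * inner (dx t) (x t - c) <= - (g t * `|x t - c| ^+ 2)}.
Hypothesis g_meas : measurable_fun (`[0, +oo[%classic : set LT) g.
Hypothesis g_range : forall t, 0 <= t -> 0 <= g t <= M.

Let cst_integrable (s t k : R) : 0 <= s -> s <= t ->
  (@leb R).-integrable (`]s, t]%classic : set LT) (EFin \o cst k).
Proof.
move=> s0 st; apply: measurable_bounded_integrable => //.
- by rewrite [X in (X < _)%E]leb_itv// ltry.
- exact: bounded_cst.
Qed.

Lemma ac_rate_integrable (t : R) : 0 <= t ->
  (@leb R).-integrable (`[0, t]%classic : set LT) (EFin \o g).
Proof.
move=> t0; apply: measurable_bounded_integrable => //.
- by rewrite [X in (X < _)%E]leb_itv// ltry.
- apply: (measurable_funS (mitv _)) g_meas.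
  by move=> r /=; rewrite !in_itv/= andbT => /andP[].
- exists M; split; first exact: num_real.
  move=> m /ltW Mm r /=; rewrite in_itv/= => /andP[r0 _].
  by have /andP[gr0 grM] := g_range r0; rewrite ger0_norm// (le_trans grM).
Qed.

Lemma ac_bounded (T : R) : exists K, 0 <= K /\
  forall t, 0 <= t <= T -> `|x t - c| <= K.
Proof.
(* The initial distance plus the integral of the speed up to T bounds the distance at every earlier
   time. *)
exists (`|x 0 - c| + \int[leb]_(r in (`]0%R, T]%classic : set LT)) `|dx r|).
split; first by rewrite addr_ge0// Rintegral_ge0.
move=> t /andP[t0 tT].
have -> : x t - c = (x 0 - c) + (x t - x 0) by rewrite [RHS]addrC subrKA.
apply: le_trans (ler_normD _ _) _; rewrite lerD2l.
apply: le_trans (ac_increment_norm (lexx 0) t0) _.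
have iT := ac_derivative_norm_integrable (lexx 0) (le_trans t0 tT).
have it := ac_derivative_norm_integrable (lexx 0) t0.
apply: fine_le; [exact: integrable_fin_num it|exact: integrable_fin_num iT|].
apply: ge0_subset_integral => //.
  exact: (measurable_int _ iT).
by move=> r /=; rewrite !in_itv/= => /andP[-> /le_trans]; apply.
Qed.

Lemma ac_lipschitz (T K s t : R) : 0 <= K ->
  (forall t, 0 <= t <= T -> `|x t - c| <= K) ->
  0 <= s -> s <= t -> t <= T -> `|x t - x s| <= L * K * (t - s).
Proof.
move=> K0 xK s0 st tT; apply: le_trans (ac_increment_norm s0 st) _.
have -> : L * K * (t - s) =
    \int[leb]_(r in (`]s, t]%classic : set LT)) (cst (L * K) r).
  by rewrite Rintegral_cst// [X in fine X]leb_itv.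
apply: ae_le_Rintegral => //.
- exact: ac_derivative_norm_integrable.
- exact: cst_integrable.
apply: (@filterS _ _ ae_leb_filter _ _ _ dx_le) => r h /=.
rewrite in_itv/= => /andP[sr rt].
have r0 := le_trans s0 (ltW sr).
by rewrite (le_trans (h r0))// ler_wpM2l// xK// r0 (le_trans rt).
Qed.

Lemma ac_gronwall (T : R) : 0 <= T ->
  `|x T - c| ^+ 2 <=
  `|x 0 - c| ^+ 2 / expR (\int[leb]_(s in (`[0%R, T]%classic : set LT)) g s).
Proof.
move=> T0; have [K [K0 xK]] := ac_bounded T.
pose Gam t := \int[leb]_(r in (`[0%R, t]%classic : set LT)) g r.
pose phi t := `|x t - c| ^+ 2.
pose psi t := phi t * expR (Gam t).
(* [C1] collects the errors of freezing time at s: the first term moves the test vector from x r - c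
   to x s - c, the second replaces |x r - c|^2 by phi s. In [C], (L K)^2 comes from |x t - x s|^2,
   and the exponential bounds exp (Gam t) for t <= T. *)
pose C1 := 2 * (L * K) ^+ 2 + M * (2 * K * (L * K)).
pose C := (C1 + (L * K) ^+ 2) * expR (Gam T).
have LK0 : 0 <= L * K by rewrite mulr_ge0.
have D0 : 0 <= C1 + (L * K) ^+ 2.
  by rewrite addr_ge0 ?sqr_ge0// addr_ge0 ?mulr_ge0 ?sqr_ge0.
have Gam0 : Gam 0 = 0.
  rewrite /Gam /Rintegral null_set_integral//.
    exact: (measurable_int _ (ac_rate_integrable (lexx 0))).
  by rewrite [LHS]leb_itv// subrr.
rewrite ler_pdivlMr ?expR_gt0//.
have -> : `|x 0 - c| ^+ 2 = psi 0 by rewrite /psi Gam0 expR0 mulr1.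
have GamD s t : 0 <= s -> s <= t ->
    Gam t = Gam s + \int[leb]_(r in (`]s, t]%classic : set LT)) g r.
  move=> s0 st; rewrite /Gam (itv0t_setU s0 st) Rintegral_setU//.
  by rewrite -itv0t_setU//; exact: ac_rate_integrable (le_trans s0 st).
have GamT t : 0 <= t -> t <= T -> Gam t <= Gam T.
  move=> t0 tT; rewrite (GamD t T t0 tT) lerDl; apply: Rintegral_ge0 => r /=.
  by rewrite in_itv/= => /andP[/ltW/(le_trans t0)/g_range/andP[]].
apply: (@le_of_quadratic_increments _ psi T C) => // s t s0 st tT.
have lip u v := @ac_lipschitz T K u v K0 xK.
have h0 : 0 <= t - s by rewrite subr_ge0.
pose G := \int[leb]_(r in (`]s, t]%classic : set LT)) g r.
have ig : (@leb R).-integrable (`]s, t]%classic : set LT) (EFin \o g).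
  apply: (integrableS (mitv _) (mitv _) (@sub_itv0 s t s0)).
  exact: ac_rate_integrable (le_trans s0 st).
have pointwise r : s <= r -> r <= t -> `|dx r| <= L * `|x r - c| ->
    2 * inner (dx r) (x r - c) <= - (g r * `|x r - c| ^+ 2) ->
    2 * inner (dx r) (x s - c) <= C1 * (t - s) - phi s * g r.
  move=> sr rt dxr dis; have r0 := le_trans s0 sr.
  have /andP[gr0 grM] := g_range r0.
  have xrK : `|x r - c| <= K by rewrite xK// r0 (le_trans rt).
  have xsK : `|x s - c| <= K by rewrite xK// s0 (le_trans st).
  have xrs : `|x r - x s| <= L * K * (t - s).
    rewrite (le_trans (lip _ _ s0 sr (le_trans rt tT)))// ler_wpM2l//.
    by rewrite lerD2r.
  have dev1 : inner (dx r) (x s - x r) <= (L * K) ^+ 2 * (t - s).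
    apply: le_trans (inner_le_norm _ _) _; rewrite expr2 -mulrA distrC.
    by apply: ler_pM => //; rewrite (le_trans dxr)// ler_wpM2l.
  have dev2 : phi s - `|x r - c| ^+ 2 <= 2 * K * (L * K) * (t - s).
    have tri : `|x s - c| <= `|x r - c| + L * K * (t - s).
      have := ler_distD (x r) (x s) c; rewrite (distrC (x s) (x r)); lra.
    (* The difference of squares is factored: its first factor is at most L K (t - s), the sum of
       norms at most 2 K. *)
    have h1 : 0 <= (L * K * (t - s) - (`|x s - c| - `|x r - c|)) *
        (`|x s - c| + `|x r - c|).
      by apply: mulr_ge0; [lra|exact: addr_ge0].
    have h2 : 0 <= L * K * (t - s) * (2 * K - (`|x s - c| + `|x r - c|)).
      by rewrite mulr_ge0 ?mulr_ge0//; lra.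
    by rewrite /phi; lra.
  have dev3 : g r * (phi s - `|x r - c| ^+ 2) <=
      M * (2 * K * (L * K) * (t - s)).
    apply: (@le_trans _ _ (g r * (2 * K * (L * K) * (t - s)))).
      by rewrite ler_wpM2l.
    by rewrite ler_wpM2r// !mulr_ge0.
  have -> : x s - c = (x s - x r) + (x r - c) by rewrite addrA subrK.
  by rewrite innerDr /C1; lra.
have phi_incr : phi t <= phi s * (1 - G) + (C1 + (L * K) ^+ 2) * (t - s) ^+ 2.
  have [iv Iv] := ac_increment_inner (x s - c) s0 st.
  have upper : 2 * inner (x t - x s) (x s - c) <=
      C1 * (t - s) ^+ 2 - phi s * G.
    have icst := cst_integrable (C1 * (t - s)) s0 st.
    have iphig := integrableZl (mitv _) (phi s) ig.
    have -> : C1 * (t - s) ^+ 2 - phi s * G =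
        \int[leb]_(r in (`]s, t]%classic : set LT))
          (C1 * (t - s) - phi s * g r).
      rewrite RintegralB// [X in _ = _ - X]RintegralZl// Rintegral_cst//.
      rewrite [X in fine X]leb_itv//.
      by rewrite expr2 mulrA.
    rewrite -Iv -RintegralZl//; apply: ae_le_Rintegral => //.
    - exact: (integrableZl (mitv _) 2 iv).
    - exact: (integrableB (mitv _) icst iphig).
    apply: (@filterS2 _ _ ae_leb_filter _ _ _ _ dx_le dissipation) => r h1 h2.
    rewrite /= in_itv/= => /andP[/ltW sr rt]; have r0 := le_trans s0 sr.
    exact: pointwise (h1 r0) (h2 r0).
  have sq : `|x t - x s| ^+ 2 <= (L * K) ^+ 2 * (t - s) ^+ 2.
    by rewrite -exprMn lerXn2r ?nnegrE ?mulr_ge0// lip.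
  (* This exact expansion around x s stands in for differentiating phi. *)
  have -> : phi t = phi s + 2 * inner (x t - x s) (x s - c) + `|x t - x s| ^+ 2.
    rewrite /phi (_ : x t - c = (x s - c) - (x s - x t)); last first.
      by rewrite opprB [RHS]addrC subrKA.
    rewrite sqr_normB -(opprB (x t)) innerNr innerC normrN; ring.
  by lra.
(* By 1 - G <= exp (- G), the loss becomes a factor that cancels the growth of exp o Gam from s to
   t. *)
have phi_exp : phi t <= phi s * expR (- G) + (C1 + (L * K) ^+ 2) * (t - s) ^+ 2.
  apply: le_trans phi_incr _; rewrite lerD2r ler_wpM2l ?sqr_ge0//.
  exact: expR_ge1Dx.
have t0 := le_trans s0 st.
rewrite /psi; apply: (@le_trans _ _ ((phi s * expR (- G) +
    (C1 + (L * K) ^+ 2) * (t - s) ^+ 2) * expR (Gam t))).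
  by rewrite ler_wpM2r// expR_ge0.
have expG : expR (- G) * expR (Gam t) = expR (Gam s).
  by rewrite -expRD (GamD s t s0 st) -/G addrCA addNr addr0.
rewrite mulrDl -mulrA expG lerD2l /C mulrAC ler_wpM2r ?sqr_ge0// ler_wpM2l//.
by rewrite ler_expR GamT.
Qed.

End Estimates.
End Gronwall.

(** * The decay rate: bounds, measurability and divergence of its integral *)

Section Rate.
Context {R : realType} (beta rho : R).
Hypotheses (beta_gt0 : 0 < beta) (rho_gt0 : 0 < rho).

Let rate (c : R) := 2 * rho * c * (beta - c) / (beta * rho * c + beta - c).

Let rate_den_gt0 c : 0 < c < beta -> 0 < beta * rho * c + beta - c.
Proof.
by move=> /andP[c0 cb]; rewrite -addrA addr_gt0 ?mulr_gt0// subr_gt0.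
Qed.

(** For the upper bound, twice the denominator exceeds the numerator by 2 rho c^2 + 2 (beta - c). *)
Lemma rate_range c : 0 < c < beta -> 0 <= rate c <= 2.
Proof.
move=> c_range; have d0 := rate_den_gt0 c_range.
have /andP[c0 cb] := c_range; have bc0 : 0 < beta - c by rewrite subr_gt0.
apply/andP; split; first by rewrite divr_ge0 ?mulr_ge0// ltW.
rewrite ler_pdivrMr//.
have : 0 <= rho * c * c by rewrite !mulr_ge0 ?ltW.
by lra.
Qed.

(** The rate is continuous on the open interval ]0, beta[, where its denominator is positive, and
    gamma takes its values there. *)
Lemma measurable_rate d (T : measurableType d) (D : set T) (gamma : T -> R) :
  measurable_fun D gamma -> (forall t, D t -> 0 < gamma t < beta) ->
  measurable_fun D (fun t => rate (gamma t)).
Proof.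
move=> mgamma gamma_range.
apply: (measurable_comp (F := `]0, beta[%classic)) mgamma => //.
  by move=> _ [t Dt <-]; rewrite /= in_itv/=; exact: gamma_range.
apply: open_continuous_measurable_fun; first exact: interval_open.
move=> c; rewrite inE/= in_itv/= => c_range.
apply: cvgM.
  apply: cvgM; first by apply: cvgM; [exact: cvg_cst|exact: cvg_id].
  by apply: cvgB; [exact: cvg_cst|exact: cvg_id].
apply: cvgV; first by rewrite gt_eqF// rate_den_gt0.
apply: cvgB; last exact: cvg_id.
apply: cvgD; last exact: cvg_cst.
by apply: cvgM; [exact: cvg_cst|exact: cvg_id].
Qed.

End Rate.

(** Monotone convergence along [0, n + 1] makes some integral reach a; since g is nonnegative, all
    longer intervals do too. *)
Lemma Rintegral_itv0_unbounded (R : realType) (g : R -> R) (M a : R) :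
  measurable_fun (`[0, +oo[%classic : set (lebesgueTypeR R)) g ->
  (forall t, 0 <= t -> 0 <= g t <= M) ->
  (\int[leb]_(s in `[0%R, +oo[) (g s)%:E = +oo)%E ->
  \forall t \near +oo, a <= \int[leb]_(s in `[0, t]) g s.
Proof.
move=> g_meas g_range int_y.
pose F (n : nat) : set (lebesgueTypeR R) := `[0, n.+1%:R]%classic.
have mF n : measurable (F n) by exact: lebesgue_measurable_itv.
have mg (t : R) : measurable_fun (`[0, t]%classic : set (lebesgueTypeR R)) g.
  apply: (measurable_funS (lebesgue_measurable_itv _)) g_meas.
  by move=> r /=; rewrite !in_itv/= andbT => /andP[].
have g0 (t r : R) : r \in `[0, t] -> (0 <= (g r)%:E)%E.
  by rewrite in_itv/= lee_fin => /andP[/g_range/andP[]].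
have := @ge0_nondecreasing_set_cvg_integral _ _ _ F (EFin \o g) (@leb R).
rewrite -itv0y_bigcup0S int_y => /(_ _ mF _ _)/cvgeyPge/(_ a) [].
- apply/nondecreasing_seqP => n; apply/subsetPset => r; rewrite /F /=.
  rewrite !in_itv/= => /andP[-> /le_trans]; apply.
  by rewrite ler_nat.
- by move=> n; exact/measurable_EFinP/mg.
- by move=> n r; exact: g0.
move=> n _ /(_ n (leqnn n)) aFn.
near=> t; rewrite -lee_fin /Rintegral fineK; last first.
  apply: integrable_fin_num; first exact: lebesgue_measurable_itv.
  exact: (ac_rate_integrable g_meas g_range).
apply: le_trans aFn _; apply: ge0_subset_integral => //.
- exact: lebesgue_measurable_itv.
- exact/measurable_EFinP/mg.
- exact: g0.
move=> r; rewrite /F /= !in_itv/= => /andP[-> /le_trans]; apply.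
by near: t; apply: nbhs_pinfty_ge; exact: num_real.
Unshelve. all: by end_near. Qed.

(** * Decay estimate and norm convergence of the trajectories *)

Theorem theorem3 (R : realType) (H : hilbertType R)
    (A : operator H) (B : H -> H) (beta rho : R) (xbar : H)
    (gamma : R -> R) (x0 : H) (x z : R -> H)
    (A_maxmono : maximally_monotone A)
    (B_mono : monotone_op (op_fun B))
    (beta_gt0 : 0 < beta)
    (B_lip : (beta^-1).-lipschitz B)
    (rho_gt0 : 0 < rho)
    (AB_strong : strongly_monotone rho (op_add A (op_fun B)))
    (xbar_zer : Zer (op_add A (op_fun B)) xbar)
    (gamma_meas : measurable_fun (`[0, +oo[ : set (lebesgueTypeR R)) gamma)
    (gamma_range : forall t : R, 0 <= t -> 0 < gamma t < beta)
    (xz_traj : is_trajectory A B gamma x0 x z) :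
  (forall t : R, 0 <= t ->
    `|x t - xbar| ^+ 2 <=
      `|x 0 - xbar| ^+ 2 /
      expR (\int[leb]_(s in `[0, t])
        (2 * rho * gamma s * (beta - gamma s) /
         (beta * rho * gamma s + beta - gamma s)))) /\
  ((\int[leb]_(s in `[0%R, +oo[)
      (2 * rho * gamma s * (beta - gamma s) /
       (beta * rho * gamma s + beta - gamma s))%:E = +oo)%E ->
    Zer (op_add A (op_fun B)) = [set xbar] /\
    x t @[t --> +oo] --> xbar).
Proof.
have [A_mono _] := A_maxmono.
have [dx [x_ac xz dyn _]] := xz_traj.
pose g s := 2 * rho * gamma s * (beta - gamma s) /
  (beta * rho * gamma s + beta - gamma s).
have g_meas : measurable_fun (`[0, +oo[ : set (lebesgueTypeR R)) g.
  apply: measurable_rate => // t /=; rewrite in_itv/= andbT.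
  exact: gamma_range.
have g_range t : 0 <= t -> 0 <= g t <= 2.
  by move=> /gamma_range; exact: rate_range.
have xz' t : 0 <= t ->
    resolvent (gamma t) A (x t - gamma t *: B (x t)) (z t).
  by move=> /xz ->.
have ae_filter : Filter (almost_everywhere (@leb R)).
  exact: (ae_filter_ringOfSetsType (@leb R)).
have dxE t : 0 = dx t + x t - z t - gamma t *: B (x t) + gamma t *: B (z t) ->
    dx t = - (x t - z t - gamma t *: B (x t) + gamma t *: B (z t)).
  by move=> /esym/eqP; rewrite -!addrA addr_eq0 !addrA => /eqP.
have dx_le : {ae @leb R, forall t : R, 0 <= t -> `|dx t| <= 6 * `|x t - xbar|}.
  apply: (@filterS _ _ ae_filter _ _ _ dyn) => t h t0.
  rewrite (dxE _ (h t0)) normrN.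
  exact: (Tseng_step_le beta_gt0 (gamma_range t t0) B_lip xbar_zer (xz' t t0)).
have dissipation : {ae @leb R, forall t : R, 0 <= t ->
    2 * inner (dx t) (x t - xbar) <= - (g t * `|x t - xbar| ^+ 2)}.
  apply: (@filterS _ _ ae_filter _ _ _ dyn) => t h t0.
  rewrite (dxE _ (h t0)) innerNl mulrN lerN2.
  exact: (Tseng_step_dissipation beta_gt0 rho_gt0 (gamma_range t t0) B_lip
    xbar_zer (xz' t t0)).
have decay t : 0 <= t -> `|x t - xbar| ^+ 2 <=
    `|x 0 - xbar| ^+ 2 / expR (\int[leb]_(s in `[0, t]) g s).
  exact: (ac_gronwall x_ac _ _ dx_le dissipation g_meas g_range).
split=> // int_y; split.
  (* Strong monotonicity between two zeros y and xbar gives rho |y - xbar|^2 <= 0. *)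
  apply/seteqP; split=> [y y_zer|_ ->//] /=.
  have := AB_strong _ _ _ _ y_zer xbar_zer.
  rewrite subrr innerC inner0l pmulr_rle0// => y_le0.
  apply/eqP; rewrite -subr_eq0 -normr_eq0 -sqrf_eq0.
  by rewrite eq_le y_le0 sqr_ge0.
apply/cvgrPdist_lt => e e0.
(* Once the integral of g reaches this level, 1 + u <= exp u makes the exponential exceed it
   strictly, so the decay bound falls below e^2. *)
have unbounded := Rintegral_itv0_unbounded (`|x 0 - xbar| ^+ 2 / e ^+ 2)
  g_meas g_range int_y.
near=> t; rewrite distrC -(@ltr_pXn2r _ 2) ?nnegrE// ?ltW//.
have t0 : 0 <= t by near: t; apply: nbhs_pinfty_ge; exact: num_real.
apply: le_lt_trans (decay t t0) _; rewrite ltr_pdivrMr ?expR_gt0//.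
have e20 : 0 < e ^+ 2 by rewrite exprn_gt0.
rewrite mulrC -ltr_pdivrMr//; apply: lt_le_trans (expR_ge1Dx _).
apply: (@le_lt_trans _ _ (\int[leb]_(s in `[0, t]) g s)); last by rewrite ltrDr.
by near: t.
Unshelve. all: by end_near. Qed.
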